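(* For each $n\geq 1$, let $Q_n$ denote the cograph of maximum global mean among all connected cographs of order $n$. If $G$ is a disconnected cograph of order $n \geq 2$, then $M_{G} \leq M_{K_{1} \cup Q_{n-1}}$.
   Context: All graphs are finite and simple with at least one vertex; the order of a graph is its number of vertices. A graph is a cograph if it contains no induced path on $4$ vertices. For a graph $G$ of order $n$, let $a_k(G)$ be the number of $k$-element vertex subsets of $G$ that induce a connected subgraph (single vertices count as connected), and let $\Phi_G(x)=\sum_{k=1}^n a_k(G)x^k$. The global mean of $G$ is $M_G=\Phi_G'(1)/\Phi_G(1)$. $G_1\cup G_2$ denotes the disjoint union of graphs, and $K_{s,t}$ the complete bipartite graph with parts of sizes $s$ and $t$. The graphs $Q_n$ are explicitly: $Q_1=K_1$, $Q_2=K_2$, $Q_3=K_3$, $Q_4=K_{2,2}$, $Q_5=K_{2,3}$, $Q_6=K_{2,4}$, and $Q_n=K_{1,n-1}$ for $n\geq 7$. *)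

(* Defs.v *)
From HB Require Import structures.
From mathcomp Require Import all_boot all_order all_algebra.

Set Implicit Arguments.
Unset Strict Implicit.
Unset Printing Implicit Defensive.

Import Order.TTheory GRing.Theory Num.Theory.

(* The vertex set may be empty, so that every vertex subset induces an sgraph;
   nonemptiness is part of [connected]. *)
Record sgraph := SGraph {
  svertex :> finType;
  sedge : rel svertex;
  sedge_sym : symmetric sedge;
  sedge_irr : irreflexive sedge
}.

Definition isomorphic (G H : sgraph) : Prop :=
  exists2 f : G -> H, bijective f &
    forall x y, sedge (f x) (f y) = sedge x y.

Section Induced.
Variables (G : sgraph) (S : {set G}).

Definition induced_rel : rel {x : G | x \in S} :=
  fun u v => sedge (val u) (val v).

Lemma induced_sym : symmetric induced_rel.
Proof. by move=> u v; rewrite /induced_rel sedge_sym. Qed.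

Lemma induced_irr : irreflexive induced_rel.
Proof. by move=> u; rewrite /induced_rel sedge_irr. Qed.

Definition induced : sgraph := SGraph induced_sym induced_irr.
End Induced.

Section Path.
Variable n : nat.

Definition path_rel : rel 'I_n :=
  fun i j => ((i : nat).+1 == j) || ((j : nat).+1 == i).

Lemma path_sym : symmetric path_rel.
Proof. by move=> i j; rewrite /path_rel orbC. Qed.

Lemma path_irr : irreflexive path_rel.
Proof. by move=> i; rewrite /path_rel orbb; elim: (i : nat). Qed.

Definition path_graph : sgraph := SGraph path_sym path_irr.
End Path.

Section Complete.
Variable n : nat.

Definition complete_rel : rel 'I_n := fun i j => i != j.

Lemma complete_sym : symmetric complete_rel.
Proof. by move=> i j; rewrite /complete_rel eq_sym. Qed.

Lemma complete_irr : irreflexive complete_rel.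
Proof. by move=> i; rewrite /complete_rel eqxx. Qed.

Definition complete_graph : sgraph := SGraph complete_sym complete_irr.
End Complete.

Section DisjointUnion.
Variables G1 G2 : sgraph.

Definition disjoint_union_rel : rel (G1 + G2)%type := fun u v =>
  match u, v with
  | inl x, inl y => sedge x y
  | inr x, inr y => sedge x y
  | _, _ => false
  end.

Lemma disjoint_union_sym : symmetric disjoint_union_rel.
Proof. by move=> [x|x] [y|y] //=; rewrite sedge_sym. Qed.

Lemma disjoint_union_irr : irreflexive disjoint_union_rel.
Proof. by move=> [x|x] /=; rewrite sedge_irr. Qed.

Definition disjoint_union : sgraph :=
  SGraph disjoint_union_sym disjoint_union_irr.
End DisjointUnion.

Definition connected (G : sgraph) : bool :=
  (0 < #|G|) && [forall x : G, forall y : G, connect (@sedge G) x y].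

Definition cograph (G : sgraph) : Prop :=
  ~ exists S : {set G}, isomorphic (induced S) (path_graph 4).

Definition num_connected (G : sgraph) (k : nat) : nat :=
  #|[set S : {set G} | (#|S| == k) && connected (induced S)]|.

Local Open Scope ring_scope.

Definition connected_set_poly (G : sgraph) : {poly rat} :=
  \sum_(1 <= k < #|G|.+1) (num_connected G k)%:R *: 'X^k.

Definition global_mean (G : sgraph) : rat :=
  (connected_set_poly G)^`().[1] / (connected_set_poly G).[1].

Definition max_mean_connected_cograph (n : nat) (Q : sgraph) : Prop :=
  [/\ #|Q| = n, cograph Q, connected Q &
    forall H : sgraph, #|H| = n -> cograph H -> connected H ->
      global_mean H <= global_mean Q].

(* Main.v *)
Require Import Defs.
From mathcomp Require Import all_boot all_order all_algebra.
From mathcomp Require Import zify.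

(* Only two numbers of a graph matter: N, the number of connected sets, and D, twice the sum of
   their sizes.  By Seinsche's theorem a cograph is built from single vertices by unions and
   joins, along which N and D obey explicit recursions, so everything becomes a statement about
   triples (m, N, D).

   If G is disconnected of order p + 1 and not K_1 plus a connected cograph, the recursions give
   D <= p N, whereas already K_1 plus a star on p vertices has mean at least p / 2, and adding
   K_1 to Q_p does at least as well, because the star minimizes N among connected cographs.
   If G = K_1 + H, adding the vertex dilutes the mean of H less when H has more connected sets,
   so M_H <= M_Q does not suffice.  Instead a reference graph T is shown to maximize the mean
   after the vertex has been added.  For p >= 7, T is the star: its N is minimal, and M_T <= M_Q,
   so that Q inherits its optimality.  For p <= 6 all pairs (N, D) are enumerated, with T one of
   K_1, K_2, K_3, K_{2,2}, K_{2,3}, K_{2,4}.  *)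

Set Implicit Arguments.
Unset Strict Implicit.
Unset Printing Implicit Defensive.

Import Order.TTheory GRing.Theory Num.Theory.

(** * P4-free relations *)

Section Seinsche.
Variable T : finType.
Implicit Types (e : rel T) (S A : {set T}).

(** For symmetric irreflexive [e] distinctness is automatic: if two of the vertices coincide, one of
    the three listed edges is present. *)
Definition p4_free e :=
  forall a b c d, e a b -> e b c -> e c d -> [|| e a c, e b d | e a d].

Definition co_rel e : rel T := fun x y => (x != y) && ~~ e x y.

Definition splits e S :=
  exists2 A, (A != set0) && (A \proper S) &
    forall x y, x \in A -> y \in S :\: A -> ~~ e x y.

Lemma co_rel_sym e : symmetric e -> symmetric (co_rel e).
Proof. by move=> es x y; rewrite /co_rel eq_sym es. Qed.

(** The path on four vertices is self-complementary: an induced path [a b c d] of the complement is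
    the path [c a d b] of [e]. Coincidences are disposed of first. *)
Lemma p4_free_co_rel e : symmetric e -> p4_free e -> p4_free (co_rel e).
Proof.
move=> es fe a b c d ab bc cd; apply/negPn/negP; rewrite !negb_or => /and3P[].
have [ca|nac] := eqVneq c a; first by rewrite -ca cd.
have [da|nad] := eqVneq d a; first by rewrite -da (co_rel_sym es) cd.
have [bd|nbd] := eqVneq b d; first by rewrite -bd ab.
rewrite /co_rel nbd eq_sym nac eq_sym nad /= !negbK => ac bd ad.
have := fe c a d b; rewrite es ac ad es bd => /(_ isT isT isT).
move: ab bc cd => /andP[_ /negPf ab] /andP[_ /negPf bc] /andP[_ /negPf cd].
by rewrite cd ab es bc.
Qed.

(** If [v] has no neighbour on one side of the split, that side still splits off; if [v] sees all of
    [S], then [v] splits off in the complement; otherwise the non-neighbours of [v] split off. *)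
Lemma splits_add e v S : symmetric e -> irreflexive e -> p4_free e ->
  v \notin S -> splits e S -> splits e (v |: S) \/ splits (co_rel e) (v |: S).
Proof.
move=> es ei fe vS [A /andP[A0 AS] sep].
have [AsS [z zS zA]] := properP AS.
have sepS x y : x \in S -> y \in S -> e x y -> (x \in A) = (y \in A).
  move=> xS yS exy; case xA: (x \in A); case yA: (y \in A) => //.
    by have := sep x y xA; rewrite inE yA yS exy => /(_ isT).
  by have := sep y x yA; rewrite inE xA xS es exy => /(_ isT).
have [/exists_inP[a aA va]|nA] := boolP [exists a in A, e v a]; last first.
  left; exists A; first rewrite A0; first apply/properP; first split.
  - exact: subset_trans AsS (subsetUr _ _).
  - by exists z; rewrite ?inE ?zS ?orbT.
  move=> x y xA; rewrite !inE => /andP[yA /orP[/eqP->|yS]].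
    by rewrite es; apply: contra nA => vx; apply/exists_inP; exists x.
  by apply: sep => //; rewrite inE yA.
have [/exists_inP[b /setDP[bS bA] vb]|nB] := boolP [exists b in S :\: A, e v b]; last first.
  left; exists (S :\: A).
    apply/andP; split; first by apply/set0Pn; exists z; rewrite inE zA.
    apply/properP; split; first exact: subset_trans (subsetDl _ _) (subsetUr _ _).
    by exists v; rewrite !inE ?eqxx ?(negPf vS) ?andbF.
  move=> x y /setDP[xS xA]; rewrite !inE negb_and negbK.
  move=> /andP[+ /orP[/eqP->|yS]] => [_|].
    by rewrite es; apply: contra nB => vx; apply/exists_inP; exists x; rewrite ?inE ?xA.
  rewrite yS orbF => yA; rewrite es; apply: sep => //; by rewrite inE xA.
have aS := subsetP AsS a aA.
have [vall|] := boolP [forall x in S, e v x].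
  right; exists [set v].
    apply/andP; split; first by apply/set0Pn; exists v; rewrite inE.
    apply/properP; split; first exact: subsetUl.
    exists a; rewrite !inE ?aS ?orbT //; by apply: contra vS => /eqP<-.
  move=> x y; rewrite !inE => /eqP-> /andP[/negPf->] /= yS.
  by rewrite /co_rel (forall_inP vall) ?andbF.
(* An edge from a non-neighbour [x] of [v] to a neighbour [y] stays on one side of the old split;
   with a neighbour [c] of [v] on the other side, [x y v c] would be an induced path. *)
rewrite negb_forall_in => /exists_inP[w wS vw]; left.
exists [set x in S | ~~ e v x].
  apply/andP; split; first by apply/set0Pn; exists w; rewrite inE wS.
  apply/properP; split; first by apply/subsetP=> x; rewrite !inE => /andP[->]; rewrite orbT.
  by exists v; rewrite !inE ?eqxx ?(negPf vS).
move=> x y; rewrite !inE => /andP[xS vx] /andP[+ /orP[/eqP->|yS]]; first by rewrite [e x v]es.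
rewrite yS negbK => vy; apply/negP => exy.
have sxy := sepS x y xS yS exy.
pose c := if x \in A then b else a.
have [vc cS cA] : [/\ e v c, c \in S & (c \in A) = ~~ (x \in A)].
  by rewrite /c; case: ifP => // _; rewrite (negPf bA).
have := fe x y v c exy; rewrite es vy => /(_ isT vc); rewrite es (negPf vx) /=.
by case/orP => /(sepS _ _ _ cS) => [/(_ yS)|/(_ xS)]; rewrite cA -?sxy; case: (x \in A).
Qed.

Lemma p4_free_splits e S : symmetric e -> irreflexive e -> p4_free e ->
  1 < #|S| -> splits e S \/ splits (co_rel e) S.
Proof.
move=> es ei fe.
have ci : irreflexive (co_rel e) by move=> x; rewrite /co_rel eqxx.
have coK R : splits (co_rel (co_rel e)) R -> splits e R.
  case=> A AR sep; exists A => // x y xA yR; have := sep x y xA yR.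
  move: yR; rewrite inE /co_rel; case: eqVneq => [<-|_]; first by rewrite xA.
  by rewrite negbK.
have [n] := ubnP #|S|; elim: n S => // n IH S leSn S2.
have /set0Pn[v vS] : S != set0 by rewrite -card_gt0 ltnW.
have defS : v |: (S :\ v) = S by rewrite setD1K.
have vS' : v \notin S :\ v by rewrite !inE eqxx.
have cS' : #|S| = #|S :\ v|.+1 by rewrite (cardsD1 v S) vS.
have [S'1|] := leqP #|S :\ v| 1.
  have /cards1P[w defS'] : #|S :\ v| == 1 by lia.
  have split1 f : ~~ f v w -> splits f S.
    move=> fvw; exists [set v].
      apply/andP; split; first by apply/set0Pn; exists v; rewrite inE.
      by rewrite properEcard sub1set vS cards1.
    by move=> x y; rewrite defS' !inE => /eqP-> /eqP->.
  have [vw|vw] := boolP (e v w); last by left; apply: split1.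
  by right; apply: split1; rewrite /co_rel vw andbF.
move=> S'2; have /IH/(_ S'2)[] : #|S :\ v| < n by lia.
  by move/(splits_add es ei fe vS'); rewrite defS.
move/(splits_add (co_rel_sym es) ci (p4_free_co_rel es fe) vS').
rewrite defS; case; [by right | by move/coK; left].
Qed.
End Seinsche.

(** * Counting connected sets *)

Section ConnectedSets.
Variable G : sgraph.
Implicit Types (S A B U : {set G}) (f : nat -> nat).

(** Trades paths in the subtype for edges leaving subsets of [S]. For the converse, the cut
    condition is applied to the set reachable from [u]. *)
Lemma connected_induced_cut S : connected (induced S) <->
  S != set0 /\ forall A, A != set0 -> A \proper S ->
    exists2 x, x \in A & exists2 y, y \in S :\: A & sedge x y.
Proof.
split.
  case/andP; rewrite card_sig card_gt0 => S0 /forallP connS.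
  split=> // A /set0Pn[x xA] /properP[AS [y yS yA]].
  have [/exists_inP[a aA /exists_inP[b bS ab]]|nE] :=
    boolP [exists a in A, exists b in S :\: A, sedge a b].
    by exists a => //; exists b.
  have xS := subsetP AS x xA.
  pose u : induced S := exist _ x xS; pose w : induced S := exist _ y yS.
  have clA : closed (@sedge (induced S)) [pred z : induced S | val z \in A].
    move=> a b ab; rewrite !inE.
    have noE c d : sedge (val c) (val d) -> val c \in A -> val (d : induced S) \in A.
      move=> cd cA; apply: contraR nE => dA; apply/exists_inP; exists (val c) => //.
      by apply/exists_inP; exists (val d); rewrite // inE dA (valP d).
    by apply/idP/idP; apply: noE => //; rewrite sedge_sym.
  have := closed_connect clA (forallP (connS u) w).
  by rewrite !inE /= xA (negPf yA).
case=> S0 cutS; apply/andP; split; first by rewrite card_sig card_gt0.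
apply/forallP=> u; apply/forallP=> w.
pose A := [set val z | z in connect (@sedge (induced S)) u].
have AS : A \subset S by apply/subsetP=> _ /imsetP[z _ ->]; apply: valP.
have [AeS|nAS] := eqVneq A S.
  have : val w \in A by rewrite AeS; apply: valP.
  by case/imsetP=> z uz /val_inj->.
have [||_ /imsetP[z uz ->] [y /setDP[yS yA] zy]] := cutS A.
- by apply/set0Pn; exists (val u); apply: imset_f; apply: connect0.
- by rewrite properEneq nAS.
case/negP: yA; apply/imsetP; exists (exist _ y yS : induced S) => //.
by apply: connect_trans uz _; apply: connect1.
Qed.

Definition disconnected_pair A B :=
  forall x y, x \in A -> y \in B -> ~~ sedge x y.
Definition complete_pair A B :=
  forall x y, x \in A -> y \in B -> sedge x y.

Lemma connected_induced1 (x : G) : connected (induced [set x]).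
Proof.
apply/connected_induced_cut; split; first by apply/set0Pn; exists x; rewrite inE.
by move=> A A0; rewrite properEneq subset1 (negPf A0) orbF => /andP[/negPf->].
Qed.

Lemma connected_induced0 : connected (induced (set0 : {set G})) = false.
Proof. by apply/negP=> /connected_induced_cut[]; rewrite eqxx. Qed.

Lemma connected_disconnected_pair A B U : disconnected_pair A B ->
  U \subset A :|: B -> connected (induced U) -> (U \subset A) || (U \subset B).
Proof.
move=> sep UAB /connected_induced_cut[U0 cutU]; apply/negPn/negP; rewrite negb_or.
case/andP=> /subsetPn[x xU xA] /subsetPn[y yU yB].
have inAB z : z \in U -> (z \in A) || (z \in B) by move/(subsetP UAB); rewrite inE.
have yA : y \in A by have := inAB y yU; rewrite (negPf yB) orbF.
have [||a /setIP[aU aA] [b]] := cutU (U :&: A).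
- by apply/set0Pn; exists y; rewrite inE yU.
- apply/properP; split; [exact: subsetIl | by exists x; rewrite // inE (negPf xA) andbF].
rewrite !inE negb_and => /andP[/orP[/negP//|bA] bU] ab.
have bB : b \in B by have := inAB b bU; rewrite (negPf bA).
by have := sep a b aA bB; rewrite ab.
Qed.

Lemma connected_complete_pair A B U : complete_pair A B ->
  U \subset A :|: B -> ~~ (U \subset A) -> ~~ (U \subset B) ->
  connected (induced U).
Proof.
move=> full UAB /subsetPn[b0 bU0 bA0] /subsetPn[a0 aU0 aB0].
have inAB z : z \in U -> (z \in A) || (z \in B) by move/(subsetP UAB); rewrite inE.
have aA0 : a0 \in A by have := inAB a0 aU0; rewrite (negPf aB0) orbF.
have bB0 : b0 \in B by have := inAB b0 bU0; rewrite (negPf bA0).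
apply/connected_induced_cut; split; first by apply/set0Pn; exists a0.
(* A path [x z y] leaving [C] does so along one of its two edges, whichever side [z] is on. *)
have step z (C : {set G}) x y : z \in U -> x \in C -> y \in U :\: C ->
    sedge x z -> sedge z y ->
    exists2 x, x \in C & exists2 y, y \in U :\: C & sedge x y.
  move=> zU xC yC xz zy; have [zC|zC] := boolP (z \in C).
    by exists z => //; exists y.
  by exists x => //; exists z; rewrite // inE zC.
move=> C /set0Pn[x xC] /properP[CU [y yU yC]].
have xU := subsetP CU x xC.
have yUC : y \in U :\: C by rewrite inE yC.
case/orP: (inAB x xU) => [xA|xB]; case/orP: (inAB y yU) => [yA|yB].
- by apply: (step b0 C x y) => //; [apply: full|rewrite sedge_sym; apply: full].
- by exists x => //; exists y => //; apply: full.
- by exists x => //; exists y => //; rewrite sedge_sym; apply: full.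
- by apply: (step a0 C x y) => //; [rewrite sedge_sym|]; apply: full.
Qed.

Definition conn_sum f S := \sum_(U : {set G} | (U \subset S) && connected (induced U)) f #|U|.
Definition subset_sum f S := \sum_(U : {set G} | U \subset S) f #|U|.

Lemma conn_sum_disconnected f A B : [disjoint A & B] -> disconnected_pair A B ->
  conn_sum f (A :|: B) = conn_sum f A + conn_sum f B.
Proof.
move=> dAB sep; rewrite /conn_sum !(big_mkcond (fun U => (U \subset _) && _)) -big_split /=.
apply: eq_bigr => U _; case cU: (connected (induced U)); rewrite ?andbF // !andbT.
case UA: (U \subset A); case UB: (U \subset B).
- suff U0 : U = set0 by rewrite U0 connected_induced0 in cU.
  by apply/eqP; rewrite -subset0; move: dAB; rewrite -setI_eq0 => /eqP<-; rewrite subsetI UA.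
- by rewrite (subset_trans UA (subsetUl _ _)) addn0.
- by rewrite (subset_trans UB (subsetUr _ _)).
case: ifP => // UAB; have := connected_disconnected_pair sep UAB cU.
by rewrite UA UB.
Qed.

(** Every subset meeting both sides is connected, so only the subsets of one side are counted
    separately. The empty set lies in both sides, hence the correction [f 0]. *)
Lemma conn_sum_complete f A B : [disjoint A & B] -> complete_pair A B ->
  conn_sum f (A :|: B) + subset_sum f A + subset_sum f B =
    subset_sum f (A :|: B) + f 0 + conn_sum f A + conn_sum f B.
Proof.
move=> dAB full.
have -> : f 0 = \sum_(U : {set G} | U == set0) f #|U| by rewrite big_pred1_eq cards0.
rewrite /conn_sum /subset_sum !(big_mkcond (fun U => (U \subset _) && _)).
rewrite !(big_mkcond (fun U : {set G} => U \subset _)).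
rewrite !(big_mkcond (fun U : {set G} => U == _)) -!big_split /=.
apply: eq_bigr => U _; have [->|U0] := eqVneq U set0.
  by rewrite !sub0set connected_induced0 /=; lia.
case UA: (U \subset A); case UB: (U \subset B) => /=.
- case/eqP: U0; apply/eqP; rewrite -subset0; move: dAB.
  by rewrite -setI_eq0 => /eqP<-; rewrite subsetI UA.
- by rewrite (subset_trans UA (subsetUl _ _)) /=; case: ifP; lia.
- by rewrite (subset_trans UB (subsetUr _ _)) /=; case: ifP; lia.
case UAB: (U \subset A :|: B) => //=.
by rewrite (connected_complete_pair full) ?UA ?UB //; lia.
Qed.

Lemma conn_sum1 f (x : G) : conn_sum f [set x] = f 1.
Proof.
rewrite /conn_sum (big_pred1 [set x]) ?cards1 // => U /=.
rewrite subset1; have [->|_] := eqVneq U [set x]; first exact: connected_induced1.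
by have [->|] := eqVneq U set0; rewrite ?connected_induced0.
Qed.

Lemma subset_sum1 S : subset_sum (fun=> 1) S = 2 ^ #|S|.
Proof. by rewrite /subset_sum sum1dep_card -card_powerset; apply: eq_card => U; rewrite !inE. Qed.

(** A subset and its complement in [S] have total size [#|S|]. *)
Lemma subset_sum2 S : subset_sum (fun k => 2 * k) S = #|S| * 2 ^ #|S|.
Proof.
rewrite -subset_sum1 /subset_sum big_distrr /=.
have -> : \sum_(U : {set G} | U \subset S) 2 * #|U| =
    \sum_(U : {set G} | U \subset S) #|U| + \sum_(U : {set G} | U \subset S) #|U|.
  by rewrite -big_split /=; apply: eq_bigr => U _; lia.
rewrite [X in _ + X](reindex_onto (fun U => S :\: U) (fun U => S :\: U)) /=; last first.
  by move=> U US; rewrite setDDr setDv set0U; apply/setIidPr.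
rewrite [X in _ + X](eq_bigl (fun U => U \subset S)); last first.
  move=> U; rewrite subsetDl setDDr setDv set0U /=.
  by apply/eqP/idP => [<-|/setIidPr//]; apply: subsetIl.
rewrite -big_split /=; apply: eq_bigr => U US.
by rewrite cardsD (setIidPr US) muln1; have := subset_leq_card US; lia.
Qed.
End ConnectedSets.

(* In [cotree m c N D], D is twice the sum of the sizes of the connected sets, which keeps the
   join recursion in the natural numbers: the subsets of an a-set have total size a 2^(a-1). *)
Inductive cotree : nat -> bool -> nat -> nat -> Prop :=
| Cotree1 : cotree 1 true 1 2
| CotreeU a b c1 c2 N1 N2 D1 D2 : cotree a c1 N1 D1 -> cotree b c2 N2 D2 ->
    cotree (a + b) false (N1 + N2) (D1 + D2)
| CotreeJ a b c1 c2 N1 N2 D1 D2 N D : cotree a c1 N1 D1 -> cotree b c2 N2 D2 ->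
    N + 2 ^ a + 2 ^ b = 2 ^ (a + b) + 1 + N1 + N2 ->
    D + a * 2 ^ a + b * 2 ^ b = (a + b) * 2 ^ (a + b) + D1 + D2 ->
    cotree (a + b) true N D.

Notation conn_count := (conn_sum (fun=> 1)).
Notation conn_weight := (conn_sum (fun k => 2 * k)).

Lemma p4_free_cotree (G : sgraph) (S : {set G}) :
  p4_free (@sedge G) -> S != set0 ->
  cotree #|S| (connected (induced S)) (conn_count S) (conn_weight S).
Proof.
move=> fG; have [n] := ubnP #|S|; elim: n S => // n IH S leSn S0.
have [S1|S1] := leqP #|S| 1.
  have /cards1P[x ->] : #|S| == 1 by rewrite -card_gt0 in S0; lia.
  by rewrite cards1 !conn_sum1 connected_induced1; constructor.
have part e : splits e S -> exists A B, [/\ A :|: B = S, [disjoint A & B],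
    A != set0 & B != set0] /\ [/\ #|A| + #|B| = #|S|, #|A| < n, #|B| < n,
    ~~ (S \subset A) & ~~ (S \subset B)] /\
    forall x y, x \in A -> y \in B -> ~~ e x y.
  case=> A /andP[A0 AS] sep; have [AsS [z zS zA]] := properP AS.
  have B0 : S :\: A != set0 by apply/set0Pn; exists z; rewrite inE zA.
  have cS := cardsID A S; rewrite (setIidPr AsS) in cS.
  exists A, (S :\: A); split; last (split; last exact: sep); split=> //.
  - by apply/setP=> x; rewrite !inE; case: (boolP (x \in A)) => //= /(subsetP AsS).
  - by rewrite disjoint_sym disjoints_subset; apply/subsetP=> x; rewrite !inE => /andP[].
  - by rewrite -card_gt0 in B0; lia.
  - by rewrite -card_gt0 in A0; lia.
  - by apply/subsetPn; exists z.
  - case/set0Pn: A0 => a aA; apply/subsetPn; exists a; first exact: (subsetP AsS).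
    by rewrite inE aA.
have [] := p4_free_splits (@sedge_sym G) (@sedge_irr G) fG S1.
  case/part=> A [B [[defS dAB A0 B0] [[cS An Bn nA nB] sep]]].
  have -> : connected (induced S) = false.
    apply/negP => /connected_disconnected_pair; move/(_ A B sep).
    by rewrite defS subxx (negPf nA) (negPf nB) => /(_ isT).
  by rewrite -cS -defS !conn_sum_disconnected //; econstructor; apply: IH.
case/part=> A [B [[defS dAB A0 B0] [[cS An Bn nA nB] sep]]].
have full : complete_pair A B.
  move=> x y xA yB; have := sep x y xA yB; rewrite /co_rel negb_and !negbK.
  by case/orP=> // /eqP xy; move/disjoint_setI0/setP/(_ x): dAB;
    rewrite !inE xA xy yB.
have -> : connected (induced S) = true.
  by apply: (connected_complete_pair full); rewrite ?defS.
have := conn_sum_complete (fun=> 1) dAB full.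
have := conn_sum_complete (fun k => 2 * k) dAB full.
rewrite defS !subset_sum1 !subset_sum2 muln0 addn0 -cS => ED EN.
exact: CotreeJ (IH A An A0) (IH B Bn B0) EN ED.
Qed.

(** * Numerical inequalities *)

Lemma rearrangement a b c d : a <= b -> c <= d -> a * d + b * c <= a * c + b * d.
Proof. by move=> /subnKC<- /subnKC<-; lia. Qed.

(** The sides have [x] and [y] nonempty subsets, so [x y] sets meet both, of doubled total size
    [a 2^a y + b 2^b x]. Estimates thereby become polynomial in [a], [b], [x], [y]. *)
Lemma join_params a b N1 N2 D1 D2 N D :
  N + 2 ^ a + 2 ^ b = 2 ^ (a + b) + 1 + N1 + N2 ->
  D + a * 2 ^ a + b * 2 ^ b = (a + b) * 2 ^ (a + b) + D1 + D2 ->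
  exists x y, [/\ 2 ^ a = x.+1, 2 ^ b = y.+1, a <= x /\ b <= y,
    N = x * y + N1 + N2 & D = a * (x.+1 * y) + b * (y.+1 * x) + D1 + D2].
Proof.
rewrite expnD; have := ltn_expl a (isT : 1 < 2); have := ltn_expl b (isT : 1 < 2).
case: (2 ^ a) (2 ^ b) => [|x] [|y] // Yb Xa EN ED; exists x, y; split=> //; lia.
Qed.

Lemma cotree_gt0 m c N D : cotree m c N D -> 0 < m.
Proof. by elim=> // *; rewrite addn_gt0; apply/orP; left. Qed.

Lemma cotree_count_ge m c N D : cotree m c N D -> m <= N.
Proof.
elim=> {m c N D} [|a b c1 c2 N1 N2 D1 D2 _ h1 _ h2|a b c1 c2 N1 N2 D1 D2 N D _ h1 _ h2] //;
  first by lia.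
by move=> EN ED; have [x [y [_ _ _ -> _]]] := join_params EN ED; lia.
Qed.

(** The star attains equality; for a join the bound comes down to [(x - 1) (y - 1) >= 0]. *)
Lemma cotree_connected_count_ge m N D : cotree m true N D ->
  2 ^ m + 2 * m <= 2 * N + 2.
Proof.
move Ec: true => c t; case: t Ec => // a b c1 c2 N1 N2 D1 D2 N' D' t1 t2 EN ED _.
have h1 := cotree_count_ge t1; have h2 := cotree_count_ge t2.
have a0 := cotree_gt0 t1; have b0 := cotree_gt0 t2.
have [x [y [Ex Ey [xa yb] -> _]]] := join_params EN ED.
rewrite expnD Ex Ey.
have := rearrangement (leq_trans a0 xa) (leq_trans b0 yb); lia.
Qed.

(** A join comes down to [(x - a) (y - b) >= 0], the singletons of the sides supplying [a b]; in a
    union each side has fewer than [m] vertices. The mean is thus at most [m / 2], or [(m + 1) / 2]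
    if connected. *)
Lemma cotree_weight_le m c N D : cotree m c N D -> D <= (m + c) * N.
Proof.
elim=> {m c N D} [|a b c1 c2 N1 N2 D1 D2 t1 h1 t2 h2|a b c1 c2 N1 N2 D1 D2 N D t1 h1 t2 h2] //.
  have a0 := cotree_gt0 t1; have b0 := cotree_gt0 t2.
  have : D1 <= (a + b) * N1 by apply: leq_trans h1 _; rewrite leq_mul2r; case: (c1); lia.
  have : D2 <= (a + b) * N2 by apply: leq_trans h2 _; rewrite leq_mul2r; case: (c2); lia.
  by rewrite /=; lia.
have {h1} : D1 <= (a + 1) * N1 by apply: leq_trans h1 _; rewrite leq_mul2r; case: (c1); lia.
have {h2} : D2 <= (b + 1) * N2 by apply: leq_trans h2 _; rewrite leq_mul2r; case: (c2); lia.
have := cotree_count_ge t1; have := cotree_count_ge t2.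
move=> g2 g1 h2 h1 EN ED; have [x [y [_ _ [xa yb] -> ->]]] := join_params EN ED.
have p1 := leq_mul (leqnn b) g1.
have p2 := leq_mul (leqnn a) g2.
have := rearrangement xa yb; rewrite /=; lia.
Qed.

(* In terms of the excess N - m over the singletons and d = (m + 1) N - D, this is
   d + (N - m) >= m (m - 1), and even d >= m (m - 1) for disconnected graphs. *)
Lemma cotree_weight_square_le m c N D : cotree m c N D ->
  D + m * m <= (m + 1 + c) * N + ~~ c * m.
Proof.
elim=> {m c N D} [|a b c1 c2 N1 N2 D1 D2 t1 h1 t2 h2|a b c1 c2 N1 N2 D1 D2 N D t1 h1 t2 h2] //.
  have g1 := cotree_count_ge t1; have g2 := cotree_count_ge t2.
  have a0 := cotree_gt0 t1; have b0 := cotree_gt0 t2.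
  have {}h1 : D1 + a * a <= (a + 2) * N1 by move: h1; case: (c1) => /=; lia.
  have {}h2 : D2 + b * b <= (b + 2) * N2 by move: h2; case: (c2) => /=; lia.
  have p1 := rearrangement b0 g1.
  have p2 := rearrangement a0 g2.
  rewrite /=; lia.
have g1 := cotree_count_ge t1; have g2 := cotree_count_ge t2.
have {}h1 : D1 + a * a <= (a + 2) * N1 by move: h1; case: (c1) => /=; lia.
have {}h2 : D2 + b * b <= (b + 2) * N2 by move: h2; case: (c2) => /=; lia.
move=> EN ED; have [x [y [_ _ [xa yb] -> ->]]] := join_params EN ED.
have p1 := leq_mul (leqnn b) g1.
have p2 := leq_mul (leqnn a) g2.
have p3 := leq_mul (leqnn y) xa.
have p4 := leq_mul (leqnn x) yb.
rewrite /=; lia.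
Qed.

(* (2^a - 1) / a is nondecreasing in a. *)
Lemma expn2_ge k a x : 0 < k -> k <= a -> 2 ^ a = x.+1 -> (2 ^ k).-1 * a <= k * x.
Proof.
move=> k0 /subnKC<-; elim: (a - k) x => [|i IH] x; first by rewrite addn0 => ->; rewrite mulnC.
rewrite addnS expnS => Ex.
case E: (2 ^ (k + i)) => [|z]; first by move: Ex; rewrite E.
have := IH z E; have := ltn_expl k (isT : 1 < 2).
have : 2 ^ k <= z.+1 by rewrite -E leq_exp2l // leq_addr.
case: (2 ^ k) => [|w] // /= h1 h2 h3.
rewrite E in Ex; have -> : x = z + z.+1 by lia.
have := leq_mul k0 h1; lia.
Qed.

(* The same with weight 2/5 on N - m; this slack absorbs the exponentially small correction in
   the mean of the star. *)
Lemma cotree_weight_square_le_large m c N D : cotree m c N D -> 4 < m ->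
  5 * D + 5 * (m * m) <= (5 * m + 7) * N + 3 * m.
Proof.
case=> [|a b c1 c2 N1 N2 D1 D2 t1 t2|{c N D} a b c1 c2 N1 N2 D1 D2 N D t1 t2 EN ED] //.
  move=> _; have t := CotreeU t1 t2; have := cotree_weight_square_le t.
  by have := cotree_count_ge t; rewrite /=; lia.
have g1 := cotree_count_ge t1; have g2 := cotree_count_ge t2.
have a0 := cotree_gt0 t1; have b0 := cotree_gt0 t2.
have h1 : D1 + a * a <= (a + 2) * N1.
  by move: (cotree_weight_square_le t1); case: (c1) => /=; lia.
have h2 : D2 + b * b <= (b + 2) * N2.
  by move: (cotree_weight_square_le t2); case: (c2) => /=; lia.
have [x [y [Ex Ey [xa yb] -> ->]]] := join_params EN ED.
(* Divided by [x y], this is [a / x + b / y <= 7/5], and the quotients do not increase with the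
   sides. Sides of 1 and 3 vertices give [1 + 3/7], slightly too much, hence [4 < m]. *)
move=> ab5; suff key : 5 * (a * y) + 5 * (b * x) <= 7 * (x * y).
  have p1 := rearrangement b0 g1.
  have p2 := rearrangement a0 g2.
  lia.
wlog ab : a b x y a0 b0 xa yb Ex Ey ab5 {c1 c2 t1 t2 EN ED h1 h2 g1 g2} / a <= b.
  move=> wH; case: (leqP a b) => [|/ltnW] ab; first exact: (wH a b).
  rewrite addnC in ab5; have := wH b a y x b0 a0 yb xa Ey Ex ab5 ab; lia.
have [b4|b4] := leqP 4 b.
  have := expn2_ge (isT : 0 < 4) b4 Ey => /= /(leq_mul (leqnn x)).
  have [a1|a1] := leqP a 1; last first.
    by have := expn2_ge (isT : 0 < 2) a1 Ex => /= /(leq_mul (leqnn y)); lia.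
  have a1' : a = 1 by lia.
  by move: Ex; rewrite a1' expn1 => -[<-]; lia.
have b3 : b = 3 by lia.
have y7 : y = 7 by move: Ey; rewrite b3 => -[].
have a2 : 1 < a by lia.
by have := expn2_ge (isT : 0 < 2) a2 Ex; rewrite /= y7 b3; lia.
Qed.

(** From 3 on, increasing the argument by one at most doubles the quadratic, so a single check at
    [k] suffices. *)
Lemma quadratic_le_expn2 r p q s k b : 2 < k -> k <= b ->
  r * k ^ 2 + p * k + q <= s * 2 ^ k -> r * b ^ 2 + p * b + q <= s * 2 ^ b.
Proof.
move=> k2 /subnKC<- hk; elim: (b - k) => [|i IH]; first by rewrite addn0.
have : 3 <= k + i by lia.
rewrite addnS (expnS 2 (k + i)); move: IH; move: (k + i) (2 ^ (k + i)) => n X IH n3.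
have h1 := leq_mul (leqnn r) (leq_mul n3 (leqnn n)).
have h2 := leq_mul (leqnn r) n3.
have h3 := leq_mul (leqnn p) n3.
rewrite -!mulnn in IH *; lia.
Qed.

(** A vertex joined to a graph on [b] vertices is compared with the star on [b + 1] vertices, both
    with an isolated vertex added. In the proof [V] counts connected sets beyond the singletons and
    [U] is the slack of the square bound; the star has [U = V = 0]. *)
Lemma star_join_vertex b c N1 D1 N D y : cotree b c N1 D1 -> 5 < b ->
  2 ^ b = y.+1 -> N = y + 1 + N1 -> D = 2 * y + b * y.+1 + 2 + D1 ->
  (D + 2) * (y.+1 + b.+1) <= (b.+2 * y.+1 + 2 * b.+1) * (N + 1).
Proof.
move=> t b5 Ey -> ->.
have b4 : 4 < b by lia.
have h5 := cotree_weight_square_le_large t b4.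
have h1 : D1 + b * b <= (b + 2) * N1.
  by move: (cotree_weight_square_le t) (cotree_count_ge t); case: (c) => /=; lia.
have hy : 5 * b ^ 2 + 2 * b + 0 <= 3 * 2 ^ b by apply: (@quadratic_le_expn2 _ _ _ _ 6).
have [V EV] : exists V, N1 = b + V by exists (N1 - b); have := cotree_count_ge t; lia.
have [U EU] : exists U, D1 + b * b + U = (b + 2) * N1.
  by exists ((b + 2) * N1 - (D1 + b * b)); lia.
have UV : 3 * V <= 5 * U by lia.
(* What remains of the goal after cancellation: [(b + 2) (y + b + 2)] exceeds the star's [D + 2] by
   [b (b + 1)]. The bound [hy] is sharp at [b = 6]. *)
have key : V * (b * b.+1) <= U * (y + b + 2).
  have q1 := leq_mul UV (leqnn (y + b + 2)).
  have : V * (5 * (b * b.+1)) <= V * (3 * (y + b + 2)).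
    by rewrite leq_mul2l; apply/orP; right; rewrite Ey in hy; lia.
  lia.
have := leq_mul (leqnn (y + b + 2)) (leqnn (D1 + b * b + U)).
rewrite [in X in _ <= X]EU EV; lia.
Qed.

(* With x = 2^a - 1 and y = 2^b - 1, this is the comparison of K_{a,b} with the star; the edges
   inside the two sides are accounted for in [cotree_star_max]. *)
Lemma star_join_bipartite a b x y T : 1 < a -> 1 < b -> 6 < a + b ->
  2 ^ a = x.+1 -> 2 ^ b = y.+1 -> 2 * T = x.+1 * y.+1 ->
  exists2 K, a * y + b * x + K + 1 = x * y + (a + b) ^ 2 &
    (a + b) * (a + b - 1) * (x * y + a + b + 1) <= K * (T + a + b).
Proof.
wlog ab : a b x y / a <= b.
  move=> wH a1 b1 ab Ex Ey ET; case: (leqP a b) => [/wH|/ltnW/wH]; first exact.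
  move=> {}wH; rewrite addnC in ab.
  have {}ET : 2 * T = y.+1 * x.+1 by lia.
  have [K EK hK] := wH y x b1 a1 ab Ey Ex ET.
  exists K; first by rewrite [x * y]mulnC [a + b]addnC; lia.
  by rewrite [x * y]mulnC -[y * x + a + b]addnA [a + b]addnC -[T + a + b]addnA
    [a + b]addnC !addnA; lia.
(* Below order nine [big] can fail, so orders seven and eight are settled by exact values of [K]. *)
move=> a1 b1; rewrite leq_eqVlt => /predU1P[|].
  move=> E; have : a = 2 /\ b = 5 \/ a = 3 /\ b = 4 by lia.
  by case=> -[-> ->]; case=> <- [<-] ET; [exists 64 | exists 80]; lia.
rewrite leq_eqVlt => /predU1P[|m9].
  move=> E; have : a = 2 /\ b = 6 \/ a = 3 /\ b = 5 \/ a = 4 /\ b = 4 by lia.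
  by case=> [|[]] -[-> ->]; case=> <- [<-] ET; [exists 108 | exists 152 | exists 168]; lia.
move=> Ex Ey ET.
(* This yields [K >= 2 (a + b) (a + b - 1)], while [x y + a + b + 1] is at most [2 (T + a + b)]: the
   factors 2 cancel. *)
have big : a * y + b * x + (a + b - 1) ^ 2 <= x * y.
  have [a2|a2] := leqP a 2.
    have ea : a = 2 by lia.
    have x3 : x = 3 by move: Ex; rewrite ea => -[].
    have := @quadratic_le_expn2 1 5 2 1 7 b isT _ isT; rewrite Ey => /(_ ltac:(lia)).
    by rewrite ea x3; lia.
  have [a3|a3] := leqP a 3.
    have ea : a = 3 by lia.
    have x7 : x = 7 by move: Ex; rewrite ea => -[].
    have := @quadratic_le_expn2 1 4 4 1 6 b isT _ isT; rewrite Ey => /(_ ltac:(lia)).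
    by rewrite ea x7; lia.
  (* Both [a / x] and [b / y] are at most 4/15. The remaining 7/15 of [x y] is at least [7 y], and
     the square is at most [4 b^2 <= 4 y]. *)
  have b5 : 5 <= b by lia.
  have hb := @quadratic_le_expn2 1 0 1 1 5 b isT b5 isT; rewrite Ey in hb.
  have hx := expn2_ge (isT : 0 < 4) a3 Ex; rewrite /= in hx.
  have hy := expn2_ge (isT : 0 < 4) (ltnW b5) Ey; rewrite /= in hy.
  have x15 : 15 <= x by lia.
  have p1 := leq_mul (leqnn y) hx.
  have p2 := leq_mul (leqnn x) hy.
  have p3 := leq_mul x15 (leqnn y).
  have p4 : (a + b - 1) * (a + b - 1) <= (2 * b) * (2 * b) by apply: leq_mul; lia.
  by rewrite -mulnn; lia.
(* The excess of [(a + b + 1) (N + 1)] over [D + 2] for K_{a,b}; for the star it is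
   [(a + b) (a + b - 1)]. *)
exists (x * y + (a + b) ^ 2 - (a * y + b * x + 1)); first by lia.
have hK : 2 * ((a + b) * (a + b - 1)) <= x * y + (a + b) ^ 2 - (a * y + b * x + 1).
  have e : (a + b - 1) ^ 2 + 2 * ((a + b) * (a + b - 1)) + 1 =
     3 * (a + b - 1) ^ 2 + 2 * (a + b - 1) + 1 by lia.
  have e2 : (a + b) ^ 2 = (a + b - 1) ^ 2 + 2 * (a + b - 1) + 1 by lia.
  lia.
have hT : x * y + a + b + 1 <= 2 * (T + a + b) by lia.
have := leq_mul hK (leqnn (T + a + b)).
have := leq_mul (leqnn ((a + b) * (a + b - 1))) hT.
lia.
Qed.

Lemma cotree_order1 c N D : cotree 1 c N D -> [/\ c = true, N = 1 & D = 2].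
Proof.
move Em: 1 => m t; case: t Em => // a b c1 c2 N1 N2 D1 D2.
  by move=> /cotree_gt0 a0 /cotree_gt0 b0; lia.
by move=> N' D' /cotree_gt0 a0 /cotree_gt0 b0; lia.
Qed.

(** Here [T + m] and [(m + 1) T + 2 m] are [N + 1] and [D + 2] of the star. When both sides of the
    join have at least two vertices, K_{a,b} is compared with the star and the [V1 + V2] further
    connected sets inside the sides are added afterwards. *)
Lemma cotree_star_max m N D T : cotree m true N D -> 6 < m -> 2 ^ m = 2 * T ->
  (D + 2) * (T + m) <= ((m + 1) * T + 2 * m) * (N + 1).
Proof.
move Ec: true => c t; case: t Ec => // a b c1 c2 N1 N2 D1 D2 {}N {}D t1 t2 EN ED _ m6 ET.
have [x [y [Ex Ey [xa yb] E1 E2]]] := join_params EN ED; clear EN ED.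
have a0 := cotree_gt0 t1; have b0 := cotree_gt0 t2.
have ET' : 2 * T = x.+1 * y.+1 by rewrite -ET expnD Ex Ey.
have [a1|a1] := leqP a 1.
  have ea : a = 1 by lia.
  move: t1 Ex; rewrite {}ea in m6 E1 E2 ET' *; case/cotree_order1=> _ en ed [ex].
  rewrite {N1}en {D1}ed -{x xa}ex in E1 E2 ET'.
  have := @star_join_vertex b c2 N2 D2 N D y t2 m6 Ey.
  have -> : T = y.+1 by lia.
  rewrite add1n !addSn !addn1 => H; apply: H; lia.
have [b1|b1] := leqP b 1.
  have eb : b = 1 by lia.
  move: t2 Ey; rewrite {}eb in m6 E1 E2 ET' *; case/cotree_order1=> _ en ed [ey].
  rewrite {N2}en {D2}ed -{y yb}ey in E1 E2 ET'.
  have := @star_join_vertex a c1 N1 D1 N D x t1.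
  have -> : T = x.+1 by lia.
  rewrite addn1 !addSn !addn1 => H; apply: H; lia.
have [K EK hK] := star_join_bipartite a1 b1 m6 Ex Ey ET'.
have g1 := cotree_count_ge t1; have g2 := cotree_count_ge t2.
have h1 : D1 + a * a <= (a + 2) * N1.
  by move: (cotree_weight_square_le t1); case: (c1) => /=; lia.
have h2 : D2 + b * b <= (b + 2) * N2.
  by move: (cotree_weight_square_le t2); case: (c2) => /=; lia.
have [V1 EV1] : exists V, N1 = a + V by exists (N1 - a); lia.
have [V2 EV2] : exists V, N2 = b + V by exists (N2 - b); lia.
(* The star's excess per set is at most 1, so a further set, raising the excess by at least 1,
   preserves the comparison. *)
have hT : (a + b) * (a + b - 1) <= T + a + b.
  have := @quadratic_le_expn2 2 0 0 1 7 (a + b) isT m6 isT; rewrite ET -mulnn; lia.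
have p1 := leq_mul b1 (leqnn V1).
have p2 := leq_mul a1 (leqnn V2).
(* [K + V1 + V2] bounds the excess of [(m + 1) (N + 1)] over [D + 2]. *)
have hD : D + 2 + K + V1 + V2 <= (a + b + 1) * (N + 1).
  rewrite E1 E2 EV1 EV2 in h1 h2 *; lia.
have q1 := leq_mul hD (leqnn (T + a + b)).
have q2 := leq_mul hT (leqnn (V1 + V2)).
have eN : N + 1 = (x * y + a + b + 1) + (V1 + V2) by lia.
have q3 : (a + b) * (a + b - 1) * (N + 1) <= (K + V1 + V2) * (T + a + b).
  by rewrite eN; lia.
lia.
Qed.

(** * Enumeration of the triples of order at most six *)

Definition cotree_join (p q : nat * (bool * nat * nat)) : bool * nat * nat :=
  let: (a, (_, N1, D1)) := p in let: (b, (_, N2, D2)) := q in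
  (true, 2 ^ (a + b) + 1 + N1 + N2 - 2 ^ a - 2 ^ b,
   (a + b) * 2 ^ (a + b) + D1 + D2 - a * 2 ^ a - b * 2 ^ b).

Definition cotree_union (p q : nat * (bool * nat * nat)) : bool * nat * nat :=
  let: (a, (_, N1, D1)) := p in let: (b, (_, N2, D2)) := q in (false, N1 + N2, D1 + D2).

Definition cotree_step (s : seq (nat * (bool * nat * nat))) m :=
  let pairs := [seq pq <- [seq (p, q) | p <- s, q <- s] | pq.1.1 + pq.2.1 == m] in
  undup ([seq (m, cotree_join pq.1 pq.2) | pq <- pairs] ++
         [seq (m, cotree_union pq.1 pq.2) | pq <- pairs]) ++ s.

Definition cotree_table :=
  foldl cotree_step [:: (1, (true, 1, 2))] (iota 2 5).

(** A computation shows the table closed under both operations up to order six; induction on the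
    cotree then applies. *)
Lemma cotree_tableP m c N D : cotree m c N D -> m <= 6 -> (m, (c, N, D)) \in cotree_table.
Proof.
have closed : all (fun p => all (fun q => if p.1 + q.1 <= 6 then
      ((p.1 + q.1, cotree_join p q) \in cotree_table) &&
      ((p.1 + q.1, cotree_union p q) \in cotree_table) else true) cotree_table) cotree_table.
  by vm_compute.
elim=> {m c N D} [|a b c1 c2 N1 N2 D1 D2 t1 h1 t2 h2 ab6|
  a b c1 c2 N1 N2 D1 D2 N D t1 h1 t2 h2 EN ED ab6].
- by vm_compute.
- have /h1/(allP closed)/allP H : a <= 6 by lia.
  have /h2/H : b <= 6 by lia.
  by rewrite ab6 => /andP[].
have /h1/(allP closed)/allP H : a <= 6 by lia.
have /h2/H : b <= 6 by lia.
rewrite ab6 => /andP[+ _].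
have -> // : cotree_join (a, (c1, N1, D1)) (b, (c2, N2, D2)) = (true, N, D).
(* By [EN] and [ED] no subtraction truncates. *)
by rewrite /cotree_join; congr (_, _, _); lia.
Qed.

(** * Reference graphs and the effect of an added vertex *)

Definition star_params m := (2 ^ m.-1 + m.-1, m.+1 * 2 ^ m.-1 + 2 * m.-1).

(** The pairs (N, D) of K_3, K_{2,2}, K_{2,3}, K_{2,4}, and otherwise of the star, which is K_1 or
    K_2 for orders 1 and 2. *)
Definition optimal_params m :=
  match m with
  | 3 => (7, 24) | 4 => (13, 56) | 5 => (26, 138) | 6 => (51, 324)
  | _ => star_params m
  end.

(** A new vertex pulls the mean towards 1, and the less so the more sets there are. With [u] and [v]
    the excesses of D over 2 N, the hypotheses give [u NQ <= v NT] and [u <= v]; the claim is their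
    sum. *)
Lemma mean_add_vertex_mono NT DT NQ DQ : 0 < NT -> NT <= NQ -> 2 * NT <= DT ->
  DT * NQ <= DQ * NT -> (DT + 2) * (NQ + 1) <= (DQ + 2) * (NT + 1).
Proof.
move=> NT0 hN /subnKC<-; move: (DT - 2 * NT) => u hu.
have hQ : 2 * NQ <= DQ by rewrite -(leq_pmul2r NT0); lia.
move: hu; rewrite -(subnKC hQ); move: (DQ - _) => v huv.
have : u <= v.
  rewrite -(leq_pmul2r NT0); have := leq_mul (leqnn u) hN; lia.
lia.
Qed.

Lemma star_params_bounds m NQ DQ : 0 < m -> cotree m true NQ DQ ->
  [/\ 0 < (star_params m).1, (star_params m).1 <= NQ &
      2 * (star_params m).1 <= (star_params m).2].
Proof.
case: m => // m _ /cotree_connected_count_ge; rewrite /star_params /= expnS.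
by have := expn_gt0 2 m; move: (2 ^ m) => X; split; lia.
Qed.

(** Up to order six all pairs of table entries are compared. Beyond, the star lies between: it beats
    (N, D) once the vertex is added, and (NQ, DQ) beats the star. *)
Lemma cotree_add_vertex_max m NQ DQ N D : cotree m true NQ DQ ->
  (optimal_params m).2 * NQ <= DQ * (optimal_params m).1 ->
  cotree m true N D -> (D + 2) * (NQ + 1) <= (DQ + 2) * (N + 1).
Proof.
move=> tQ hQ t; have m0 := cotree_gt0 t.
have [m6|m6] := leqP m 6.
  have table : all (fun q => let: (m, (_, NQ, DQ)) := q in
      if (optimal_params m).2 * NQ <= DQ * (optimal_params m).1 then
      all (fun h => let: (m', (c, N, D)) := h in
        if (m' == m) && c then (D + 2) * (NQ + 1) <= (DQ + 2) * (N + 1) else true)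
        cotree_table else true)
      [seq q <- cotree_table | q.2.1.1].
    by vm_compute.
  have := allP table (m, (true, NQ, DQ)).
  rewrite mem_filter (cotree_tableP tQ m6) hQ => /(_ isT) /allP.
  by move=> /(_ _ (cotree_tableP t m6)); rewrite eqxx.
have {}hQ : (star_params m).2 * NQ <= DQ * (star_params m).1.
  by case: (m) m6 hQ => [|[|[|[|[|[|[|k]]]]]]].
have [S0 SQ SD] := star_params_bounds m0 tQ.
have hSQ := mean_add_vertex_mono S0 SQ SD hQ.
have hS : (D + 2) * ((star_params m).1 + 1) <= ((star_params m).2 + 2) * (N + 1).
  have ET : 2 ^ m = 2 * 2 ^ m.-1 by rewrite -expnS prednK.
  have := cotree_star_max t m6 ET; rewrite /star_params /=.
  have -> : 2 ^ m.-1 + m.-1 + 1 = 2 ^ m.-1 + m by lia.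
  by have -> : m.+1 * 2 ^ m.-1 + 2 * m.-1 + 2 = (m + 1) * 2 ^ m.-1 + 2 * m by lia.
move: (star_params m) S0 hSQ hS => [NS DS] /= _ hSQ hS.
have NS0 : 0 < NS + 1 by lia.
rewrite -(leq_pmul2r NS0).
have := leq_mul hS (leqnn (NQ + 1)); have := leq_mul hSQ (leqnn (N + 1)); lia.
Qed.

Lemma cotree_disconnected_max m NQ DQ N D : cotree m true NQ DQ ->
  (star_params m).2 * NQ <= DQ * (star_params m).1 ->
  (optimal_params m).2 * NQ <= DQ * (optimal_params m).1 ->
  cotree m.+1 false N D -> D * (NQ + 1) <= (DQ + 2) * N.
Proof.
move=> tQ hS hQ t; have m0 := cotree_gt0 tQ.
(* Q with a vertex added has mean at least [m / 2], as the star does. This settles all cases but a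
   single vertex beside a connected graph. *)
have coarse : D <= m * N -> D * (NQ + 1) <= (DQ + 2) * N.
  have [S0 SQ SD] := star_params_bounds m0 tQ.
  have hSQ := mean_add_vertex_mono S0 SQ SD hS => hD.
  suff : m * (NQ + 1) <= DQ + 2.
    by move/(leq_mul (leqnn N)); have := leq_mul hD (leqnn (NQ + 1)); lia.
  have S1 : 0 < (star_params m).1 + 1 by lia.
  rewrite -(leq_pmul2r S1); apply: leq_trans hSQ.
  suff : m * ((star_params m).1 + 1) <= (star_params m).2 + 2.
    by move/(leq_mul (leqnn (NQ + 1))); lia.
  rewrite /star_params /=.
  (* Equality holds at [m = 4]; small orders are checked individually. *)
  suff : m ^ 2 <= 2 ^ m.-1 + 2 * m by rewrite -mulnn; lia.
  have [m7|m7] := leqP 7 m.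
    have := @quadratic_le_expn2 2 0 0 1 7 m isT m7 isT.
    by have := expnS 2 m.-1; rewrite prednK //; lia.
  by case: (m) m7 => [|[|[|[|[|[|[|k]]]]]]].
move: t; move Em: m.+1 => m'; move Ec: false => c t; move: t Em Ec coarse.
case=> // a b c1 c2 N1 N2 D1 D2; wlog : a b c1 c2 N1 N2 D1 D2 / a <= b.
  move=> wH; case: (leqP a b) => [|/ltnW] ab t1 t2; first exact: wH ab t1 t2.
  by rewrite addnC [N1 + _]addnC [D1 + _]addnC; apply: wH ab t2 t1.
move=> ab t1 t2 Em _ coarse.
have g1 := cotree_weight_le t1; have g2 := cotree_weight_le t2.
have a0 := cotree_gt0 t1; have c1N := cotree_count_ge t1.
have [a1|a1] := leqP a 1; last first.
  apply: coarse.
  have : (a + c1) * N1 <= m * N1 by rewrite leq_mul2r; case: (c1); lia.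
  have : (b + c2) * N2 <= m * N2 by rewrite leq_mul2r; case: (c2); lia.
  lia.
have ea : a = 1 by lia.
have eb : b = m by lia.
subst a b; have [_ eN eD] := cotree_order1 t1; subst N1 D1.
case: c2 t2 g2 => [t2 _|t2 g2].
  by have := cotree_add_vertex_max tQ hQ t2; lia.
apply: coarse.
(* The single vertex contributes 2 to D, which is at most [m] unless [m = 1]; then the other part is
   a vertex too, hence connected. *)
have [m1|m1] := leqP m 1; last by lia.
have em : m = 1 by lia.
by move: t2; rewrite em => /cotree_order1[].
Qed.

(** * Means *)

Lemma connected_surjective_hom (H K : sgraph) (f : H -> K) :
  (forall y, exists x, f x = y) -> (forall x y, sedge x y -> sedge (f x) (f y)) ->
  connected H -> connected K.
Proof.
move=> fsurj fhom /andP[/card_gt0P[x0 _] /forallP connH]; apply/andP; split.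
  by apply/card_gt0P; exists (f x0).
apply/forallP=> y; apply/forallP=> y'; have [x <-] := fsurj y; have [x' <-] := fsurj y'.
have /connectP[p + ->] := forallP (connH x) x'.
elim: p x => [|z p IH] x /=; first by rewrite connect0.
by case/andP=> xz /IH; apply: connect_trans; apply: connect1; apply: fhom.
Qed.

Lemma connected_induced_setT (G : sgraph) :
  connected (induced [set: G]) = connected G.
Proof.
apply/idP/idP.
  apply: (@connected_surjective_hom (induced [set: G]) G val) => // y.
  by exists (exist _ y (in_setT y)).
apply: (@connected_surjective_hom G (induced [set: G]) (fun x => exist _ x (in_setT x))) => // y.
by exists (val y); apply: val_inj.
Qed.

Section Embedding.
Variables (H G : sgraph) (h : H -> G).
Hypothesis h_inj : injective h.
Hypothesis h_edge : forall x y, sedge (h x) (h y) = sedge x y.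

Lemma connected_induced_imset (U : {set H}) :
  connected (induced (h @: U)) = connected (induced U).
Proof.
apply/idP/idP=> /connected_induced_cut[U0 cutU]; apply/connected_induced_cut; split.
- by apply: contra U0 => /eqP->; rewrite imset0.
- move=> A A0 AU; have [||_ /imsetP[x xA ->] [y + xy]] := cutU (h @: A).
  + by rewrite imset_eq0.
  + have [AsU [z zU zA]] := properP AU; apply/properP; split; first exact: imsetS.
    by exists (h z); [apply: imset_f|rewrite mem_imset].
  case/setDP=> /imsetP[z zU ez]; rewrite ez mem_imset // => zA.
  by exists x => //; exists z; rewrite ?inE ?zA // -h_edge -ez.
- by rewrite imset_eq0.
move=> A A0 /properP[AU [y /imsetP[z zU ->] zA]].
have [||x + [w + xw]] := cutU (h @^-1: A).
- case/set0Pn: A0 => x xA; have /imsetP[w _ ex] := subsetP AU x xA.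
  by apply/set0Pn; exists w; rewrite inE -ex.
- apply/properP; split; last by exists z; rewrite ?inE.
  by apply/subsetP=> x; rewrite inE => /(subsetP AU); rewrite mem_imset.
rewrite !inE => xA /andP[wA wU]; exists (h x) => //; exists (h w).
  by rewrite inE wA imset_f.
by rewrite h_edge.
Qed.

(** Carries the sums of two graphs into their disjoint union, where [conn_sum_disconnected]
    applies. *)
Lemma conn_sum_imset f (S : {set H}) : conn_sum f (h @: S) = conn_sum f S.
Proof.
rewrite /conn_sum (reindex_onto (fun U : {set H} => h @: U) (fun V => h @^-1: V)) /=.
  apply: eq_big => [U|U _]; last by rewrite card_imset.
  have -> : h @^-1: (h @: U) = U by apply/setP=> x; rewrite inE mem_imset.
  rewrite eqxx andbT connected_induced_imset; congr (_ && _).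
  by apply/idP/idP=> [/subsetP US|/imsetS->//];
    apply/subsetP=> x /(imset_f h)/US; rewrite mem_imset.
move=> V /andP[VS _]; apply/setP=> y; apply/imsetP/idP => [[x + ->]|yV]; first by rewrite inE.
by have /imsetP[x _ ey] := subsetP VS y yV; exists x; rewrite ?inE -?ey.
Qed.
End Embedding.

(** A connected set is nonempty, so its size occurs exactly once in the range of [k]. *)
Lemma sum_num_connected (G : sgraph) (f : nat -> nat) :
  \sum_(1 <= k < #|G|.+1) num_connected G k * f k = conn_sum f [set: G].
Proof.
under eq_bigr => k _.
  rewrite /num_connected -sum1_card big_distrl /=.
  under eq_bigl => S do rewrite inE andbC.
  rewrite big_mkcondr /=; over.
rewrite exchange_big /= /conn_sum; under [RHS]eq_bigl => S do rewrite subsetT.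
apply: eq_bigr => S cS.
have S0 : 0 < #|S| by rewrite card_gt0; case/connected_induced_cut: cS.
under eq_bigr => k _ do rewrite eq_sym.
by rewrite -big_mkcond big_nat1_eq S0 ltnS max_card mul1n.
Qed.

Lemma global_meanE (G : sgraph) :
  (global_mean G = (conn_weight [set: G])%:R / (2 * conn_count [set: G])%:R)%R.
Proof.
rewrite /global_mean.
have -> : ((connected_set_poly G).[1] = (conn_count [set: G])%:R)%R.
  rewrite -sum_num_connected natr_sum horner_sum; apply: eq_bigr => k _.
  by rewrite hornerZ hornerXn expr1n mulr1 muln1.
have -> : (conn_weight [set: G] = 2 * conn_sum id [set: G])%N.
  by rewrite /conn_sum big_distrr.
have -> : ((connected_set_poly G)^`().[1] = (conn_sum id [set: G])%:R)%R.
  rewrite -sum_num_connected natr_sum raddf_sum horner_sum; apply: eq_bigr => k _ /=.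
  by rewrite derivZ derivXn hornerZ hornerMn hornerXn expr1n natrM.
by rewrite !natrM -mulf_div divff ?mul1r.
Qed.

Lemma global_mean_le (G H : sgraph) :
  0 < conn_count [set: G] -> 0 < conn_count [set: H] ->
  (global_mean G <= global_mean H)%R =
  (conn_weight [set: G] * conn_count [set: H] <= conn_weight [set: H] * conn_count [set: G]).
Proof.
move=> G0 H0; rewrite !global_meanE.
rewrite ler_pdivrMr ?ltr0n ?muln_gt0 // mulrAC ler_pdivlMr ?ltr0n ?muln_gt0 //.
rewrite -!natrM ler_nat; apply/idP/idP; lia.
Qed.

Lemma conn_sum_disjoint_union f (G1 G2 : sgraph) :
  conn_sum f [set: disjoint_union G1 G2] = conn_sum f [set: G1] + conn_sum f [set: G2].
Proof.
rewrite -(@conn_sum_imset G1 (disjoint_union G1 G2) inl) //; last by move=> ? ? [].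
rewrite -(@conn_sum_imset G2 (disjoint_union G1 G2) inr) //; last by move=> ? ? [].
rewrite -conn_sum_disconnected; first congr conn_sum.
- apply/setP=> -[x|x]; rewrite !inE; symmetry; apply/orP; [left|right]; exact: imset_f.
- by rewrite disjoints_subset; apply/subsetP=> _ /imsetP[x _ ->]; rewrite inE; apply/imsetP=> -[].
by move=> _ _ /imsetP[x _ ->] /imsetP[y _ ->].
Qed.

Lemma conn_sum_complete_graph1 f : conn_sum f [set: complete_graph 1] = f 1.
Proof.
have -> : [set: complete_graph 1] = [set (ord0 : complete_graph 1)].
  by apply/setP=> x; rewrite !inE; apply/esym/eqP; rewrite [x]ord1.
exact: conn_sum1.
Qed.

Lemma cograph_p4_free (G : sgraph) : cograph G -> p4_free (@sedge G).
Proof.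
move=> cG a b c d ab bc cd; apply: contra_notT cG => /norP[ac /norP[bd ad]].
pose s := [tuple a; b; c; d]; pose S := tnth s @: [set: 'I_4].
exists S; pose g (i : path_graph 4) : induced S :=
  exist _ (tnth s i) (imset_f _ (in_setT (i : 'I_4))).
have gE i j : sedge (g i) (g j) = sedge i j.
  rewrite /= /induced_rel /= /path_rel !(tnth_nth a) /=.
  case: i j => [[|[|[|[|//]]]] ?] [[|[|[|[|//]]]] ?] //=;
    rewrite ?sedge_irr // ?ab ?bc ?cd // ?(negPf ac, negPf bd, negPf ad) //;
    by rewrite sedge_sym ?ab ?bc ?cd // ?(negPf ac, negPf bd, negPf ad).
(* Adjacency to the vertices 0, 1 and 3 already tells the vertices of the path apart, so injectivity
   follows from [gE]. *)
have g_inj : injective g.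
  move=> i j eg; have row k : path_rel i k = path_rel j k.
    by have := gE i k; rewrite eg gE.
  apply: val_inj; move: (row (@Ordinal 4 0 isT)) (row (@Ordinal 4 1 isT)) (row (@Ordinal 4 3 isT)).
  by case: i j {eg row} => [[|[|[|[|//]]]] ?] [[|[|[|[|//]]]] ?].
have g_surj x : x \in codom g.
  case: x => x xS; have /imsetP[i _ ex] := xS.
  by apply/codomP; exists i; apply: val_inj.
pose f x := iinv (g_surj x).
have fK : cancel f g by move=> x; rewrite f_iinv.
exists f; first by exists g => // i; apply: g_inj; rewrite fK.
by move=> x y; rewrite -gE !fK.
Qed.

(** * Complete multipartite graphs as reference graphs *)

Section Multipartite.
Variables (V : finType) (colour : V -> nat).

Definition multipartite_rel : rel V := fun x y => colour x != colour y.

Lemma multipartite_sym : symmetric multipartite_rel.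
Proof. by move=> x y; rewrite /multipartite_rel eq_sym. Qed.

Lemma multipartite_irr : irreflexive multipartite_rel.
Proof. by move=> x; rewrite /multipartite_rel eqxx. Qed.

Definition multipartite : sgraph := SGraph multipartite_sym multipartite_irr.

(** Non-adjacency is equality of colours, hence transitive; in the path 0 misses both 2 and 3, which
    are adjacent. *)
Lemma multipartite_cograph : cograph multipartite.
Proof.
case=> S [f [g fK gK] fE].
have gE i j : sedge (g i) (g j) = path_rel i j by rewrite -fE !gK.
pose v (i : 'I_4) : multipartite := val (g i).
have cE i j : (colour (v i) != colour (v j)) = path_rel i j by rewrite -gE.
pose o k (hk : k < 4) := Ordinal hk.
have /negbFE/eqP c02 := cE (@o 0 isT) (@o 2 isT).
have /negbFE/eqP c03 := cE (@o 0 isT) (@o 3 isT).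
have := cE (@o 2 isT) (@o 3 isT).
by rewrite -c02 -c03 eqxx.
Qed.

Lemma conn_sum_monochromatic f (S : {set multipartite}) :
  {in S &, forall x y, colour x = colour y} -> conn_sum f S = #|S| * f 1.
Proof.
have [n] := ubnP #|S|; elim: n S => // n IH S leSn mono.
have [->|/set0Pn[x xS]] := eqVneq S set0.
  rewrite cards0 /conn_sum big_pred0 // => U; rewrite subset0.
  by case: eqVneq => // ->; rewrite connected_induced0.
rewrite -{1}(setD1K xS) conn_sum_disconnected ?conn_sum1 ?IH.
- by rewrite (cardsD1 x S) xS mulnDl mul1n.
- by move: leSn; rewrite (cardsD1 x S) xS.
- by move=> y z /setD1P[_ yS] /setD1P[_ zS]; apply: mono.
- by rewrite disjoints1 !inE eqxx.
move=> y z /set1P-> /setD1P[_ zS].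
by rewrite /= /multipartite_rel negbK; apply/eqP/mono.
Qed.
End Multipartite.

Definition bipartite s t : sgraph :=
  multipartite (fun v : 'I_s + 'I_t => if v is inl _ then 0 else 1).

Lemma bipartite_setT s t : exists A B : {set bipartite s t},
  [/\ A :|: B = setT, [disjoint A & B], complete_pair A B, #|A| = s & #|B| = t] /\
  [/\ conn_count A = s, conn_weight A = 2 * s, conn_count B = t & conn_weight B = 2 * t].
Proof.
pose A : {set bipartite s t} := inl @: [set: 'I_s].
pose B : {set bipartite s t} := inr @: [set: 'I_t].
have cA : #|A| = s by rewrite card_imset ?cardsT ?card_ord // => ? ? [].
have cB : #|B| = t by rewrite card_imset ?cardsT ?card_ord // => ? ? [].
have mA f : conn_sum f A = s * f 1.
  by rewrite conn_sum_monochromatic ?cA // => _ _ /imsetP[x _ ->] /imsetP[y _ ->].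
have mB f : conn_sum f B = t * f 1.
  by rewrite conn_sum_monochromatic ?cB // => _ _ /imsetP[x _ ->] /imsetP[y _ ->].
exists A, B; split; split; rewrite ?mA ?mB //; try lia.
- apply/setP=> -[x|x]; rewrite !inE; apply/orP; [left|right]; exact: imset_f.
- by rewrite disjoints_subset; apply/subsetP=> _ /imsetP[x _ ->]; rewrite inE; apply/imsetP=> -[].
by move=> _ _ /imsetP[x _ ->] /imsetP[y _ ->].
Qed.

Lemma bipartite_connected s t : 0 < s -> 0 < t -> connected (bipartite s t).
Proof.
move=> s0 t0; rewrite -connected_induced_setT.
have [A [B [[defV dAB full cA cB] _]]] := bipartite_setT s t.
have ltV (C C' : {set bipartite s t}) : [disjoint C & C'] ->
    0 < #|C'| -> ~~ (setT \subset C).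
  move=> dCC'; rewrite card_gt0 => /set0Pn[x xC']; apply/subsetPn; exists x => //.
  by apply/negP=> xC; move/disjoint_setI0: dCC' => /setP/(_ x); rewrite !inE xC xC'.
apply: (connected_complete_pair full); rewrite ?defV ?subsetT //.
  by apply: (ltV A B) => //; rewrite cB.
by apply: (ltV B A); rewrite 1?disjoint_sym ?cA.
Qed.

Lemma bipartite_params s t :
  conn_count [set: bipartite s t] + 2 ^ s + 2 ^ t = 2 ^ (s + t) + 1 + s + t /\
  conn_weight [set: bipartite s t] + s * 2 ^ s + t * 2 ^ t =
    (s + t) * 2 ^ (s + t) + 2 * s + 2 * t.
Proof.
have [A [B [[defV dAB full cA cB] [NA DA NB DB]]]] := bipartite_setT s t.
have cV : #|[set: bipartite s t]| = s + t by rewrite cardsT card_sum !card_ord.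
have := conn_sum_complete (fun=> 1) dAB full.
have := conn_sum_complete (fun k => 2 * k) dAB full.
by rewrite defV !subset_sum1 !subset_sum2 cA cB cV NA NB DA DB muln0 addn0.
Qed.

Definition triangle : sgraph := multipartite (val : 'I_3 -> nat).

Lemma triangle_params : connected triangle /\
  conn_count [set: triangle] = 7 /\ conn_weight [set: triangle] = 24.
Proof.
have full (A B : {set triangle}) : [disjoint A & B] -> complete_pair A B.
  move=> dAB x y xA yB; rewrite /= /multipartite_rel val_eqE; apply/negP=> /eqP exy.
  by move/disjoint_setI0: dAB => /setP/(_ x); rewrite !inE xA exy yB.
pose v k (hk : k < 3) : triangle := Ordinal hk.
pose v0 := @v 0 isT; pose v1 := @v 1 isT; pose v2 := @v 2 isT.
(* The triangle is built by two joins: [v1] with [v2], then [v0] with both. *)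
have d12 : [disjoint [set v1] & [set v2]] by rewrite disjoints1 inE.
have d0 : [disjoint [set v0] & [set v1; v2]] by rewrite disjoints1 !inE.
have defV : [set v0] :|: [set v1; v2] = [set: triangle].
  by apply/setP=> x; rewrite !inE; case: x => [[|[|[|//]]] ?].
split.
  rewrite -connected_induced_setT; apply: (connected_complete_pair (full _ _ d0)).
  - by rewrite defV.
  - by apply/subsetPn; exists v1; rewrite !inE.
  - by apply/subsetPn; exists v0; rewrite !inE.
have c12 : #|[set v1; v2]| = 2 by rewrite cards2.
have cV : #|[set: triangle]| = 3 by rewrite cardsT card_ord.
have := conn_sum_complete (fun=> 1) d12 (full _ _ d12).
have := conn_sum_complete (fun k => 2 * k) d12 (full _ _ d12).
have := conn_sum_complete (fun=> 1) d0 (full _ _ d0).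
have := conn_sum_complete (fun k => 2 * k) d0 (full _ _ d0).
rewrite defV !subset_sum1 !subset_sum2 !conn_sum1 c12 cV !cards1; lia.
Qed.

Lemma cograph_cotree (G : sgraph) : cograph G -> 0 < #|G| ->
  cotree #|G| (connected G) (conn_count [set: G]) (conn_weight [set: G]).
Proof.
move=> /cograph_p4_free fG G0; rewrite -connected_induced_setT -[X in cotree X]cardsT.
by apply: p4_free_cotree; rewrite // -card_gt0 cardsT.
Qed.

Lemma cotree_count_gt0 m c N D : cotree m c N D -> 0 < N.
Proof. by move=> t; apply: leq_trans (cotree_gt0 t) (cotree_count_ge t). Qed.

(** * Comparison of Q with the reference graphs *)

Section MaximalMean.
Variables (m : nat) (Q : sgraph).
Hypotheses (m_gt0 : 0 < m) (maxQ : max_mean_connected_cograph m Q).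
Let NQ := conn_count [set: Q].
Let DQ := conn_weight [set: Q].

Lemma max_mean_cotree : cotree m true NQ DQ.
Proof.
by case: maxQ => cQ coQ conQ _; rewrite -cQ -[true]conQ; apply: cograph_cotree; rewrite ?cQ.
Qed.

Lemma max_mean_multipartite (V : finType) (colour : V -> nat) :
  let T := multipartite colour in #|T| = m -> connected T ->
  conn_weight [set: T] * NQ <= DQ * conn_count [set: T].
Proof.
move=> T cT conT; case: maxQ => cQ coQ conQ maxm.
rewrite -global_mean_le; first by apply: maxm => //; apply: multipartite_cograph.
  have T0 : 0 < #|T| by rewrite cT.
  exact: cotree_count_gt0 (cograph_cotree (@multipartite_cograph _ colour) T0).
exact: cotree_count_gt0 max_mean_cotree.
Qed.

(** Keeping N and D variable lets numerical pairs be inserted directly. *)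
Lemma max_mean_bipartite s t N D : 0 < s -> 0 < t -> s + t = m ->
  N + 2 ^ s + 2 ^ t = 2 ^ m + 1 + m ->
  D + s * 2 ^ s + t * 2 ^ t = m * 2 ^ m + 2 * m ->
  D * NQ <= DQ * N.
Proof.
move=> s0 t0 st EN ED; have [EN' ED'] := bipartite_params s t.
have := @max_mean_multipartite _ _ _ (bipartite_connected s0 t0).
rewrite -/(bipartite s t) [#|_|]card_sum !card_ord => /(_ st).
rewrite st in EN' ED'.
have -> : conn_count [set: bipartite s t] = N by lia.
by have -> : conn_weight [set: bipartite s t] = D by lia.
Qed.

Lemma max_mean_star : (star_params m).2 * NQ <= DQ * (star_params m).1.
Proof.
(* For [m = 1] the star K_{1,0} has an empty side, so the single vertex is treated apart. *)
have [m1|m1] := leqP m 1.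
  have t := max_mean_cotree; have em : m = 1 by lia.
  by move: t; rewrite em => /cotree_order1[_ -> ->].
have Em : m = m.-1.+1 by lia.
apply: (@max_mean_bipartite 1 m.-1); rewrite ?add1n -?Em //; first lia.
  by rewrite /star_params /=; move: (m.-1) Em => k ->; rewrite (expnS 2 k); lia.
by rewrite /star_params /=; move: (m.-1) Em => k ->; rewrite (expnS 2 k); lia.
Qed.

Lemma max_mean_optimal : (optimal_params m).2 * NQ <= DQ * (optimal_params m).1.
Proof.
have := max_mean_star; have := max_mean_bipartite.
have := @max_mean_multipartite _ (val : 'I_3 -> nat).
case: m => [|[|[|[|[|[|[|k]]]]]]] //= tri bip _.
- by have [c [<- <-]] := triangle_params; apply: tri; rewrite ?card_ord.
- exact: (bip 2 2).
- exact: (bip 2 3).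
- exact: (bip 2 4).
Qed.
End MaximalMean.

Theorem theorem5p3 (Q : nat -> sgraph)
    (hQ : forall m : nat, (1 <= m)%N -> max_mean_connected_cograph m (Q m))
    (n : nat) (G : sgraph) :
  (2 <= n)%N -> #|G| = n -> cograph G -> ~~ connected G ->
  (global_mean G
     <= global_mean (disjoint_union (complete_graph 1) (Q n.-1)))%R.
Proof.
move=> n2 cG coG /negPf dG; have n0 : 0 < n.-1 by lia.
have maxQ := hQ n.-1 n0; have tQ := max_mean_cotree n0 maxQ.
have tG : cotree n.-1.+1 false (conn_count [set: G]) (conn_weight [set: G]).
  have -> : n.-1.+1 = #|G| by lia.
  by rewrite -dG; apply: cograph_cotree => //; lia.
rewrite global_mean_le.
- rewrite !conn_sum_disjoint_union !conn_sum_complete_graph1.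
  have := cotree_disconnected_max tQ (max_mean_star n0 maxQ) (max_mean_optimal n0 maxQ) tG.
  lia.
- exact: cotree_count_gt0 tG.
by rewrite conn_sum_disjoint_union conn_sum_complete_graph1 add1n.
Qed.
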